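(* A Nagata ring is semi-Nagata. In particular, a Nagata domain $R$ has a finite $(S_2)$-ification, that is, there is a finite inclusion of integral domains $R\to C$ such that $C$ is $(S_2)$ and $R_{\mathfrak{p}}=C_{\mathfrak{p}}$ for all primes $\mathfrak{p}$ of $R$ of height $1$.
   Context: A Nagata ring is a Noetherian ring $R$ such that every finite $R$-algebra that is an integral domain has a normalization (integral closure in its fraction field) that is finite over it. $(S_2)$ denotes Serre's condition: a Noetherian ring $A$ is $(S_2)$ if $\operatorname{depth}A_{\mathfrak{p}}\geq\min\{2,\dim A_{\mathfrak{p}}\}$ for all primes $\mathfrak p$. A finite inclusion is an injective finite ring map. A ring $R$ is semi-Nagata if $R$ is Noetherian and for every finite $R$-algebra $B$ that is an integral domain there is a finite inclusion of integral domains $B\to C$ so that $C$ is $(S_2)$ and $B_{\mathfrak{p}}=C_{\mathfrak{p}}$ for all primes $\mathfrak{p}$ of $B$ of height $1$. *)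

(* Defs.v *)
From HB Require Import structures.
From mathcomp Require Import all_boot all_order all_algebra.
From mathcomp Require Import ring.
From mathcomp Require Import boolp classical_sets constructive_ereal.

Set Implicit Arguments.
Unset Strict Implicit.
Unset Printing Implicit Defensive.

Import Order.TTheory GRing.Theory Num.Theory.
Local Open Scope ring_scope.
Local Open Scope classical_set_scope.
Local Open Scope quotient_scope.

(* The A-submodule of B generated by s, where A acts on B through f. *)
Definition lin_span (A B : comPzRingType) (f : A -> B) (s : seq B) : set B :=
  [set b | exists c : 'I_(size s) -> A, b = \sum_(i < size s) f (c i) * s`_i].

Definition finite_map (A B : comPzRingType) (f : A -> B) : Prop :=
  exists s : seq B, lin_span f s = [set: B].

(* [idealr] of ring_quotient only covers proper ideals of nonzero rings. *)
Definition is_ideal (A : comPzRingType) (I : set A) : Prop :=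
  I 0 /\ forall a x y, I x -> I y -> I (a * x + y).

Definition noetherian (A : comPzRingType) : Prop :=
  forall I : set A, is_ideal I -> exists s : seq A, I = lin_span idfun s.

Definition integral_closure (B : idomainType) : set {fraction B} :=
  [set x | integralOver (@tofrac B) x].

Arguments integral_closure : clear implicits.

Arguments integral_closure : clear implicits.

Definition finite_normalization (B : idomainType) : Prop :=
  exists s : seq {fraction B}, integral_closure B = lin_span (@tofrac B) s.

Definition nagata (R : comPzRingType) : Prop :=
  noetherian R /\
  forall (B : idomainType) (f : {rmorphism R -> B}),
    finite_map f -> finite_normalization B.

(* The localization of A at p: pairs (a, s) with s outside p, modulo
   (a, s) ~ (b, t) iff u * (a * t) = u * (b * s) for some u outside p. *)
Section Localization.
Variables (A : comNzRingType) (p : prime_idealr A).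

Lemma prime_compl1 : (1 : A) \notin p.
Proof. by rewrite idealr1. Qed.

Lemma prime_complM (s t : A) : s \notin p -> t \notin p -> s * t \notin p.
Proof. by move=> sp tp; rewrite prime_idealrM negb_or sp. Qed.

Definition locpair := {x : A * A | x.2 \notin p}.
Implicit Types x y z : locpair.

Definition numer x : A := (val x).1.
Definition denom x : A := (val x).2.

Lemma denomP x : denom x \notin p. Proof. exact: (valP x). Qed.

Definition mkloc (a s : A) (sp : s \notin p) : locpair :=
  exist (fun x : A * A => x.2 \notin p) (a, s) sp.

Definition loc_equiv x y : bool :=
  `[< exists2 u : A, u \notin p &
        u * (numer x * denom y) = u * (numer y * denom x) >].

Lemma loc_equivP x y :
  reflect (exists2 u : A, u \notin p &
             u * (numer x * denom y) = u * (numer y * denom x))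
          (loc_equiv x y).
Proof. exact: asboolP. Qed.

Lemma loc_equiv_refl : reflexive loc_equiv.
Proof. by move=> x; apply/loc_equivP; exists 1 => //; exact: prime_compl1. Qed.

Lemma loc_equiv_sym : symmetric loc_equiv.
Proof.
by move=> x y; apply/idP/idP => /loc_equivP[u up e]; apply/loc_equivP; exists u.
Qed.

Lemma loc_equiv_trans : transitive loc_equiv.
Proof.
move=> y x z /loc_equivP[u up e1] /loc_equivP[v vp e2]; apply/loc_equivP.
exists (u * v * denom y); first by rewrite !prime_complM ?denomP.
transitivity (v * denom z * (u * (numer x * denom y))); first by ring.
transitivity (u * denom x * (v * (numer y * denom z))); last by rewrite e2; ring.
by rewrite e1; ring.
Qed.

Canonical loc_equiv_equiv :=
  EquivRel loc_equiv loc_equiv_refl loc_equiv_sym loc_equiv_trans.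

Definition localization := {eq_quot loc_equiv}.
HB.instance Definition _ : EqQuotient _ loc_equiv localization :=
  EqQuotient.on localization.
HB.instance Definition _ := Choice.on localization.


Lemma locP x y :
  reflect (exists2 u : A, u \notin p &
             u * (numer x * denom y) = u * (numer y * denom x))
          (\pi_localization x == \pi_localization y).
Proof. by rewrite eqmodE; exact: loc_equivP. Qed.

Lemma loc_pi_eq x y : numer x * denom y = numer y * denom x ->
  \pi_localization x = \pi_localization y.
Proof.
by move=> e; apply/eqP/locP; exists 1; rewrite ?prime_compl1 ?e.
Qed.

Definition addl x y : locpair :=
  mkloc (numer x * denom y + numer y * denom x)
        (prime_complM (denomP x) (denomP y)).
Definition mull x y : locpair :=
  mkloc (numer x * numer y) (prime_complM (denomP x) (denomP y)).
Definition oppl x : locpair := mkloc (- numer x) (denomP x).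
Definition embl (a : A) : locpair := mkloc a prime_compl1.

Definition loc_add := lift_op2 localization addl.
Definition loc_mul := lift_op2 localization mull.
Definition loc_opp := lift_op1 localization oppl.
Definition toloc := lift_embed localization embl.
Canonical toloc_pi_morph := PiEmbed toloc.

Lemma loc_reprP x : exists2 u : A, u \notin p &
  u * (numer x * denom (repr (\pi_localization x))) =
  u * (numer (repr (\pi_localization x)) * denom x).
Proof. by apply/locP; rewrite reprK. Qed.

Lemma pi_loc_add : {morph \pi : x y / addl x y >-> loc_add x y}.
Proof.
move=> x y; unlock loc_add; apply/eqP/locP.
have [[u up eu] [v vp ev]] := (loc_reprP x, loc_reprP y).
move: (repr _) eu (repr _) ev => x' eu y' ev.
exists (u * v); first exact: prime_complM.
rewrite [numer (addl _ _)]/numer [denom (addl _ _)]/denom.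
rewrite [numer (addl _ _)]/numer [denom (addl _ _)]/denom /=.
transitivity (v * denom y * denom y' * (u * (numer x * denom x')) +
              u * denom x * denom x' * (v * (numer y * denom y'))).
  by ring.
by rewrite eu ev; ring.
Qed.
Canonical pi_loc_add_morph := PiMorph2 pi_loc_add.

Lemma pi_loc_mul : {morph \pi : x y / mull x y >-> loc_mul x y}.
Proof.
move=> x y; unlock loc_mul; apply/eqP/locP.
have [[u up eu] [v vp ev]] := (loc_reprP x, loc_reprP y).
move: (repr _) eu (repr _) ev => x' eu y' ev.
exists (u * v); first exact: prime_complM.
rewrite [numer (mull _ _)]/numer [denom (mull _ _)]/denom.
rewrite [numer (mull _ _)]/numer [denom (mull _ _)]/denom /=.
transitivity (u * (numer x * denom x') * (v * (numer y * denom y'))).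
  by ring.
by rewrite eu ev; ring.
Qed.
Canonical pi_loc_mul_morph := PiMorph2 pi_loc_mul.

Lemma pi_loc_opp : {morph \pi : x / oppl x >-> loc_opp x}.
Proof.
move=> x; unlock loc_opp; apply/eqP/locP; have [u up eu] := loc_reprP x.
exists u => //; rewrite [numer (oppl _)]/numer [denom (oppl _)]/denom.
rewrite [numer (oppl _)]/numer [denom (oppl _)]/denom /=.
by rewrite !mulNr !mulrN eu.
Qed.
Canonical pi_loc_opp_morph := PiMorph1 pi_loc_opp.

Lemma loc_addA : associative loc_add.
Proof.
elim/quotW=> x; elim/quotW=> y; elim/quotW=> z; rewrite !piE.
by apply: loc_pi_eq; rewrite /addl /numer /denom /=; ring.
Qed.

Lemma loc_addC : commutative loc_add.
Proof.
elim/quotW=> x; elim/quotW=> y; rewrite !piE.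
by apply: loc_pi_eq; rewrite /addl /numer /denom /=; ring.
Qed.

Lemma loc_add0 : left_id (toloc 0) loc_add.
Proof.
elim/quotW=> x; rewrite !piE.
by apply: loc_pi_eq; rewrite /addl /numer /denom /=; ring.
Qed.

Lemma loc_addN : left_inverse (toloc 0) loc_opp loc_add.
Proof.
elim/quotW=> x; rewrite !piE.
by apply: loc_pi_eq; rewrite /addl /numer /denom /=; ring.
Qed.

HB.instance Definition _ := GRing.isZmodule.Build localization
  loc_addA loc_addC loc_add0 loc_addN.

Lemma loc_mulA : associative loc_mul.
Proof.
elim/quotW=> x; elim/quotW=> y; elim/quotW=> z; rewrite !piE.
by apply: loc_pi_eq; rewrite /mull /numer /denom /=; ring.
Qed.

Lemma loc_mulC : commutative loc_mul.
Proof.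
elim/quotW=> x; elim/quotW=> y; rewrite !piE.
by apply: loc_pi_eq; rewrite /mull /numer /denom /=; ring.
Qed.

Lemma loc_mul1 : left_id (toloc 1) loc_mul.
Proof.
elim/quotW=> x; rewrite !piE.
by apply: loc_pi_eq; rewrite /mull /numer /denom /=; ring.
Qed.

Lemma loc_mulDl : left_distributive loc_mul loc_add.
Proof.
elim/quotW=> x; elim/quotW=> y; elim/quotW=> z; rewrite !piE.
by apply: loc_pi_eq; rewrite /mull /addl /numer /denom /=; ring.
Qed.

Lemma loc_1neq0 : toloc 1 != toloc 0.
Proof.
rewrite !piE; apply/loc_equivP => -[u up]; rewrite /numer /denom /= !mulr1 mulr0.
by move=> u0; rewrite u0 idealr0 in up.
Qed.

HB.instance Definition _ := GRing.Zmodule_isComNzRing.Build localization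
  loc_mulA loc_mulC loc_mul1 loc_mulDl loc_1neq0.

End Localization.

Section DepthDimension.
Variable A : comNzRingType.
Local Open Scope ereal_scope.

Definition ext_nat (n : nat) : \bar int := (n%:Z)%:E.

Definition prime_chain (n : nat) (c : 'I_n.+1 -> prime_idealr A) : Prop :=
  forall i j : 'I_n.+1, (i < j)%N ->
    {subset c i <= c j} /\ ~ {subset c j <= c i}.

(* [supremum] returns its default -oo only on the empty set here: every
   nonempty set of naturals has a least upper bound in \bar int. *)
Definition krull_dim : \bar int :=
  supremum -oo [set ext_nat n | n in
    [set n | exists c : 'I_n.+1 -> prime_idealr A, prime_chain c]].

Definition height (p : prime_idealr A) : \bar int :=
  supremum -oo [set ext_nat n | n in
    [set n | exists c : 'I_n.+1 -> prime_idealr A,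
       prime_chain c /\ c ord_max =i p]].

Definition regular_sequence (s : seq A) : Prop :=
  (forall i, (i < size s)%N -> forall a : A,
     lin_span idfun (take i s) (s`_i * a)%R -> lin_span idfun (take i s) a) /\
  ~ lin_span idfun s 1%R.

(* The maximal ideal of A when A is local. *)
Definition nonunits : set A := [set x | forall y : A, (x * y != 1)%R].

(* The depth of A when A is Noetherian local. *)
Definition depth : \bar int :=
  supremum -oo [set ext_nat (size s) | s in
    [set s : seq A | regular_sequence s /\ forall x, x \in s -> nonunits x]].

End DepthDimension.

Definition serre_S2 (A : comNzRingType) : Prop :=
  noetherian A /\
  forall p : prime_idealr A,
    (mine (ext_nat 2) (krull_dim (localization p)) <= depth (localization p))%E.

(* The image of B_p -> Frac C and of C_p = (B \ p)^-1 C -> Frac C, for an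
   inclusion g : B -> C of domains and a prime p of B; both maps are injective. *)
Definition loc_base (B C : idomainType) (g : B -> C) (p : prime_idealr B) :
    set {fraction C} :=
  [set x | exists b s, s \notin p /\ x = tofrac (g b) / tofrac (g s)].

Definition loc_ext (B C : idomainType) (g : B -> C) (p : prime_idealr B) :
    set {fraction C} :=
  [set x | exists (c : C) (s : B), s \notin p /\ x = tofrac c / tofrac (g s)].

Definition has_finite_S2_ification (B : idomainType) : Prop :=
  exists (C : idomainType) (g : {rmorphism B -> C}),
    [/\ injective g, finite_map g, serre_S2 C &
        forall p : prime_idealr B, height p = ext_nat 1 ->
          loc_base g p = loc_ext g p].

Definition semi_nagata (R : comPzRingType) : Prop :=
  noetherian R /\
  forall (B : idomainType) (f : {rmorphism R -> B}),
    finite_map f -> has_finite_S2_ification B.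

(* Main.v *)
(**
Let B be a Noetherian domain with finite normalization B' and fraction field K.
The hull C, made of the x in B' lying in B_p for every prime p of height 1, is
a submodule of B', hence finite over B, and C_p = B_p at each such p.

For (S_2), let 0 < P < Q be primes of C and let x in K satisfy Q x <= C.  For
p in P and q in Q \ P, q (p x) = p (q x) is in P, so P x <= P and x is integral.
If x were not in C, it would be outside B_p for some p of height 1; then every
b in B with b in Q has x b in B_p, so b is in p.  Hence P and Q both contract
to p, against incomparability.  So Q x <= C forces x in C, which excludes that
Q consists of zero divisors modulo a nonzero element of P.
*)
Require Import Defs.
From HB Require Import structures.
From mathcomp Require Import all_boot all_order all_algebra.
From mathcomp Require Import ring.
From mathcomp Require Import boolp classical_sets constructive_ereal.

Set Implicit Arguments.
Unset Strict Implicit.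
Unset Printing Implicit Defensive.

Import Order.TTheory GRing.Theory Num.Theory.
Local Open Scope ring_scope.
Local Open Scope classical_set_scope.
Local Open Scope quotient_scope.

(** * Spans and submodules along a ring map *)

Section LinSpan.
Variables (A D : comPzRingType) (f : {rmorphism A -> D}).
Implicit Types (s t : seq D) (N : set D) (b x y : D).

Definition is_submodule N :=
  N 0 /\ forall a x y, N x -> N y -> N (f a * x + y).

Lemma submoduleD N x y : is_submodule N -> N x -> N y -> N (x + y).
Proof. by move=> [_ h] Nx /(h 1 _ _ Nx); rewrite rmorph1 mul1r. Qed.

Lemma submoduleB N x y : is_submodule N -> N x -> N y -> N (x - y).
Proof.
by move=> hN Nx Ny; have [_ h] := hN; have := h (-1) _ _ Ny Nx;
  rewrite rmorphN1 mulN1r addrC.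
Qed.

Lemma lin_span_nil b : lin_span f [::] b <-> b = 0.
Proof.
split=> [[c ->]|->]; first by rewrite big_ord0.
by exists (fun=> 0); rewrite big_ord0.
Qed.

Lemma lin_span_cons x s b :
  lin_span f (x :: s) b <->
  exists a y, lin_span f s y /\ b = f a * x + y.
Proof.
split=> [[c ->]|[a [_ [[c ->] ->]]]].
  rewrite big_ord_recl /=.
  exists (c ord0), (\sum_(i < size s) f (c (lift ord0 i)) * s`_i).
  by split=> //; exists (fun i => c (lift ord0 i)).
exists (fun i => oapp c a (unlift ord0 i)).
rewrite big_ord_recl /= unlift_none /=; congr (_ + _).
by apply: eq_bigr => i _; rewrite liftK.
Qed.

Lemma lin_span_submodule s : is_submodule (lin_span f s).
Proof.
elim: s => [|x s [h0 hD]].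
  by split=> [|a x y]; rewrite !lin_span_nil // => -> ->; rewrite mulr0 addr0.
split=> [|a u v]; rewrite !lin_span_cons.
  by exists 0, 0; split=> //; rewrite rmorph0 mul0r addr0.
move=> [b [y [sy ->]]] [c [z [sz ->]]]; exists (a * b + c), (f a * y + z).
by split; [exact: hD | rewrite rmorphD rmorphM; ring].
Qed.

Lemma mem_lin_span s x : x \in s -> lin_span f s x.
Proof.
elim: s => // y s IH; rewrite inE => /predU1P[<-|/IH sx]; apply/lin_span_cons.
  exists 1, 0; split; first exact: (lin_span_submodule s).1.
  by rewrite rmorph1 mul1r addr0.
by exists 0, x; split=> //; rewrite rmorph0 mul0r add0r.
Qed.

Lemma lin_span_sub N s : is_submodule N -> (forall x, x \in s -> N x) ->
  lin_span f s `<=` N.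
Proof.
move=> hN; elim: s => [|y s IH] sN b.
  by move/lin_span_nil ->; exact: hN.1.
case/lin_span_cons => a [z [sz ->]]; apply: hN.2; first exact/sN/mem_head.
by apply: IH => // u us; apply: sN; rewrite inE us orbT.
Qed.

Lemma is_ideal_submodule (I : set D) : is_ideal I -> is_submodule I.
Proof. by case=> I0 h; split=> // a x y; exact: h. Qed.

End LinSpan.

Lemma idealE (A : comPzRingType) (I : set A) :
  is_ideal I -> is_submodule idfun I.
Proof. by []. Qed.

(** * Finite generation over Noetherian rings *)

Section NoetherianModule.
Variables (A D : comPzRingType) (f : {rmorphism A -> D}).
Hypothesis noethA : noetherian A.

(** Induction on the generators. For a list [x :: s], the part of [N] inside the span of [s] is
    handled by induction, and the possible coefficients at [x] of elements of [N] form an ideal of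
    [A]. Lifting finitely many generators of this ideal to [N] supplies the missing generators. *)
Lemma submodule_fg (s : seq D) (N : set D) : is_submodule f N ->
  N `<=` lin_span f s -> exists t, N = lin_span f t.
Proof.
elim: s N => [|x s IH] N hN sN.
  exists [::]; apply/seteqP; split=> // b /lin_span_nil ->; exact: hN.1.
have [t defN'] : exists t, N `&` lin_span f s = lin_span f t.
  apply: IH => [|b []//]; have hs := lin_span_submodule f s.
  by split=> [|a u v [Nu su] [Nv sv]]; split; [exact: hN.1 | exact: hs.1
    | exact: hN.2 | exact: hs.2].
pose I : set A := [set a | exists2 y, lin_span f s y & N (f a * x + y)].
have /noethA[r defI] : is_ideal I.
  have hs := lin_span_submodule f s; split.
    exists 0; first exact: hs.1.
    by rewrite rmorph0 mul0r addr0; exact: hN.1.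
  move=> a u v [y sy Ny] [z sz Nz]; exists (f a * y + z); first exact: hs.2.
  suff -> : f (a * u + v) * x + (f a * y + z) =
            f a * (f u * x + y) + (f v * x + z) by apply: hN.2.
  by rewrite rmorphD rmorphM; ring.
(* [g a] is a chosen element of [N] with coefficient [a] at [x]. *)
have [g gP] : exists g : A -> D, forall a, I a -> N (g a) /\
    lin_span f s (g a - f a * x).
  have h a : exists y, I a -> N y /\ lin_span f s (y - f a * x).
    have [[y sy Ny]|nI] := pselect (I a); last by exists 0.
    by exists (f a * x + y) => _; split=> //; rewrite addrC addKr.
  by exists (fun a => projT1 (cid (h a))) => a; case: cid.
exists (map g r ++ t); have ht := lin_span_submodule f (map g r ++ t).
have rI a : a \in r -> I a by rewrite defI; exact: mem_lin_span.
apply/seteqP; split=> [b Nb|]; last first.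
  apply: lin_span_sub => // z; rewrite mem_cat => /orP[/mapP[a ar ->]|zt].
    by have [] := gP a (rI a ar).
  by have [] : (N `&` lin_span f s) z by rewrite defN'; exact: mem_lin_span.
have /lin_span_cons[a [y [sy eb]]] := sN _ Nb.
have : I a by exists y => //; rewrite -eb.
rewrite defI => Ia.
have [u [tu Nu su]] : exists u, [/\ lin_span f (map g r ++ t) u, N u &
    lin_span f s (u - f a * x)].
  have hs := lin_span_submodule f s.
  pose liftable := [set a | exists u, [/\ lin_span f (map g r ++ t) u, N u &
    lin_span f s (u - f a * x)]].
  apply: (@lin_span_sub _ _ idfun liftable r) Ia => [|c cr] /=.
    split=> [|c v w [u1 [? ? ?]] [u2 [? ? ?]]].
      by exists 0; split; [exact: ht.1 | exact: hN.1 |];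
        rewrite rmorph0 mul0r subr0; exact: hs.1.
    exists (f c * u1 + u2); split; [exact: ht.2|exact: hN.2|].
    have -> : f c * u1 + u2 - f (idfun c * v + w) * x =
      f c * (u1 - f v * x) + (u2 - f w * x) by rewrite /= rmorphD rmorphM; ring.
    exact: hs.2.
  have [Nc sc] := gP c (rI c cr); exists (g c); split=> //.
  by apply: mem_lin_span; rewrite mem_cat map_f.
rewrite -(subrK u b) addrC; apply: (submoduleD ht tu).
have : (N `&` lin_span f s) (b - u).
  split; first exact: submoduleB hN Nb Nu.
  have -> : b - u = y - (u - f a * x) by rewrite eb; ring.
  exact: submoduleB (lin_span_submodule f s) sy su.
rewrite defN'; apply: lin_span_sub => // z zt.
by apply: mem_lin_span; rewrite mem_cat zt orbT.
Qed.

(** Ideals of [D] are [A]-submodules, and generators over [A] also generate over [D]. *)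
Lemma finite_noetherian : finite_map f -> noetherian D.
Proof.
move=> [s defD] I hI.
have [|t It] := @submodule_fg s I (is_ideal_submodule f hI).
  by rewrite defD.
exists t; apply/seteqP; split; last first.
  apply: (lin_span_sub (idealE hI)) => x xt; rewrite It; exact: mem_lin_span.
have [h0 h] := lin_span_submodule (idfun : D -> D) t.
rewrite It; apply: lin_span_sub => [|x]; last exact: mem_lin_span.
by split=> // a x y; exact: h.
Qed.

End NoetherianModule.

(** Without a maximal member, choice builds a strictly increasing sequence in [F]. Its union is a
    finitely generated ideal, so all generators already lie in one term, where the sequence must
    stop. *)
Lemma noetherian_maximal (A : comPzRingType) (F : set (set A)) :
  noetherian A -> F !=set0 -> (forall I, F I -> is_ideal I) ->
  exists2 I, F I & forall J, F J -> I `<=` J -> J = I.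
Proof.
move=> noethA [I0 FI0] hF; apply: contrapT => nmax.
have step (I : {I | F I}) : {J : {I | F I} | projT1 I `<=` projT1 J /\
    projT1 I <> projT1 J}.
  apply: cid; apply: contrapT => nJ; apply: nmax.
  exists (projT1 I) => [|J FJ IJ].
    exact: projT2.
  apply: contrapT => JI; apply: nJ; exists (exist _ J FJ); split=> //= e.
  by apply: JI.
pose u n := projT1 (iter n (fun I => projT1 (step I)) (exist _ I0 FI0)).
have uF n : F (u n) by exact: projT2.
have uS n : u n `<=` u n.+1 /\ u n <> u n.+1.
  by rewrite {2 4}/u iterS; case: (step _).
have uM m n : (m <= n)%N -> u m `<=` u n.
  move/subnK <-; elim: (n - m)%N => // k IH; rewrite addSn.
  exact: subset_trans (uS _).1.
have /noethA[s defs] : is_ideal [set x | exists n, u n x].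
  split; first by exists 0%N; exact: (hF _ (uF 0%N)).1.
  move=> a x y [m mx] [n ny]; exists (maxn m n); apply: (hF _ (uF _)).2.
    exact: uM (leq_maxl _ _) _ mx.
  exact: uM (leq_maxr _ _) _ ny.
have [n sn] : exists n, forall x, x \in s -> u n x.
  have : forall x, x \in s -> exists n, u n x.
    move=> x xs; suff: [set x | exists n, u n x] x by [].
    by rewrite defs; exact: mem_lin_span.
  elim: (s) => [_|x r IH h]; first by exists 0%N.
  have [|m mP] := IH; first by move=> y yr; apply: h; rewrite inE yr orbT.
  have [k kx] := h x (mem_head _ _); exists (maxn m k) => y.
  rewrite inE => /predU1P[->|yr]; first exact: uM (leq_maxr _ _) _ kx.
  exact: uM (leq_maxl _ _) _ (mP _ yr).
apply: (uS n).2; apply/seteqP; split; first exact: (uS n).1.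
move=> x xn; have : [set x | exists n, u n x] x by exists n.+1.
rewrite defs; apply: (lin_span_sub (idealE (hF _ (uF n)))) => //.
Qed.

(** * Suprema of sets of naturals in [\bar int] *)

Lemma ext_nat_supremums (N : set nat) :
  supremums [set ext_nat n | n in N] !=set0.
Proof.
(* The supremum is +oo for an unbounded set, -oo for the empty set, and the maximum otherwise. *)
have [nb|] := pselect (forall m, exists2 n, N n & (m < n)%N).
  exists +oo%E; split=> [_ [n Nn <-]|y yub]; first exact: leey.
  case: y yub => [k||] yub //.
    have [n Nn kn] := nb `|k|%N.
    have : (ext_nat n <= k%:E)%E by apply: yub; exists n.
    rewrite lee_fin => nk.
    have := le_lt_trans nk (le_lt_trans (lez_abs k) (kn : `|k| < n :> int)%R).
    by rewrite ltxx.
  have [n Nn _] := nb 0%N.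
  by have : (ext_nat n <= -oo)%E by apply: yub; exists n.
move=> /existsNP[m mP].
have Nm n : N n -> (n <= m)%N.
  by move=> Nn; rewrite leqNgt; apply/negP => mn; apply: mP; exists n.
have [[n0 Nn0]|N0] := pselect (exists n, N n); last first.
  exists -oo%E; split=> [z [n Nn _]|y _]; last exact: leNye.
  by case: N0; exists n.
have exN : exists n, `[< N n >] by exists n0; apply/asboolP.
have ubN n : `[< N n >] -> (n <= m)%N by move/asboolP; exact: Nm.
case: (ex_maxnP exN ubN) => k /asboolP Nk kP.
exists (ext_nat k); split=> [_ [n Nn <-]|y yub]; last by apply: yub; exists k.
by rewrite lee_fin lez_nat; apply: kP; apply/asboolP.
Qed.

Lemma ext_nat_le_supremum (N : set nat) n : N n ->
  (ext_nat n <= supremum -oo [set ext_nat m | m in N])%E.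
Proof.
by move=> Nn; apply: ge_supremum_Nmem; [exact: ext_nat_supremums | exists n].
Qed.

Lemma supremum_ext_nat_le (N : set nat) y :
  (forall n, N n -> (ext_nat n <= y)%E) ->
  (supremum -oo [set ext_nat m | m in N] <= y)%E.
Proof.
(* On the empty set the default -oo lies below every [y]. *)
move=> Ny; rewrite /supremum; case: ifP => _; first exact: leNye.
case: xgetP => [z _ [_ zle]|/(_ _)]; last first.
  by have [z zP] := ext_nat_supremums N => /(_ z).
by apply: zle => _ [n Nn <-]; exact: Ny.
Qed.

(** * Prime ideals as sets *)

Section PrimeSet.
Variable A : comNzRingType.

(** Primes are handled as plain sets, so that preimages, annihilators and the zero ideal need no
    structure of their own; [prime_of] packs such a set when a chain of primes has to be built. *)
Definition is_prime (P : set A) : Prop :=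
  [/\ is_ideal P, ~ P 1 & forall x y, P (x * y) -> P x \/ P y].

Lemma prime_idealr_is_prime (p : prime_idealr A) : is_prime [set x | x \in p].
Proof.
split=> /=; last by move=> x y; rewrite prime_idealrM => /orP.
  split; first exact: idealr0.
  by move=> a x y px py; rewrite /= rpredD // idealMr.
by rewrite idealr1.
Qed.

Section Pack.
Variables (P : set A) (hP : is_prime P).

Definition prime_pred : {pred A} := fun x => `[< P x >].

Fact prime_pred_idealr : idealr_closed prime_pred.
Proof.
have [[P0 PD] P1 _] := hP; split; first exact/asboolP.
  by apply/negP => /asboolP.
by move=> a x y /asboolP Px /asboolP Py; apply/asboolP; exact: PD.
Qed.

Fact prime_pred_prime : prime_idealr_closed prime_pred.
Proof.
have [_ _ PM] := hP; move=> x y /asboolP/PM[Px|Py]; apply/orP.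
  by left; apply/asboolP.
by right; apply/asboolP.
Qed.

HB.instance Definition _ := isIdealr.Build A prime_pred prime_pred_idealr.
HB.instance Definition _ :=
  isPrimeIdealrClosed.Build A prime_pred prime_pred_prime.

Definition prime_of : prime_idealr A := prime_pred.

Lemma mem_prime_of x : (x \in prime_of) <-> P x.
Proof. by split=> [/asboolP|Px]; last apply/asboolP. Qed.

End Pack.

End PrimeSet.

Lemma zero_prime (A : idomainType) : is_prime [set 0 : A].
Proof.
split=> /=; first by split=> //= a x y -> ->; rewrite mulr0 addr0.
  by apply/eqP; rewrite oner_eq0.
by move=> x y /eqP; rewrite mulf_eq0 => /orP[]/eqP; [left|right].
Qed.

Lemma preimage_prime (A C : comNzRingType) (f : {rmorphism A -> C})
  (P : set C) : is_prime P -> is_prime (f @^-1` P).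
Proof.
move=> [[P0 PD] P1 PM]; split; rewrite /preimage /=.
- by split=> [|a x y Px Py] /=; rewrite ?rmorph0 // rmorphD rmorphM; exact: PD.
- by rewrite rmorph1.
- by move=> x y; rewrite rmorphM; exact: PM.
Qed.

(** * Prime avoidance *)

Section PrimeAvoidance.
Variable A : comNzRingType.

Lemma ideal_mull (J : set A) a x : is_ideal J -> J x -> J (a * x).
Proof. by case=> J0 JD Jx; have := JD a x 0 Jx J0; rewrite addr0. Qed.

Lemma ideal_mulr (J : set A) a x : is_ideal J -> J x -> J (x * a).
Proof. by rewrite mulrC; exact: ideal_mull. Qed.

Lemma ideal_sub (J : set A) x y : is_ideal J -> J x -> J y -> J (x - y).
Proof. by move=> hJ Jx Jy; exact: (submoduleB (idealE hJ)). Qed.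

(** Choose an element outside [P] in each ideal; their product stays outside the prime [P]. *)
Lemma avoid_meet (T : eqType) (P : set A) (Ps : T -> set A) (s : seq T) :
  is_prime P -> (forall i, i \in s -> is_ideal (Ps i)) ->
  (forall i, i \in s -> ~ Ps i `<=` P) ->
  exists2 a, ~ P a & forall i, i \in s -> Ps i a.
Proof.
move=> [_ P1 PM]; elim: s => [|i s IH] hs nsP; first by exists 1.
have [||a nPa aP] := IH.
- by move=> j js; apply: hs; rewrite inE js orbT.
- by move=> j js; apply: nsP; rewrite inE js orbT.
have /existsNP[b /not_implyP[ib nPb]] := nsP i (mem_head _ _).
exists (b * a) => [/PM[]//|j]; rewrite inE => /predU1P[->|js].
  by apply: ideal_mulr ib; apply/hs/mem_head.
by apply: ideal_mull (aP j js); apply: hs; rewrite inE js orbT.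
Qed.

(** If [b] in [Q] avoids the later primes but lies in [Ps i], it is corrected by a term [q * a] with
    [q] in [Q], which lies in all the later primes but not in [Ps i]. *)
Lemma prime_avoidance (T : eqType) (Q : set A) (Ps : T -> set A) (s : seq T) :
  is_ideal Q -> (forall i, i \in s -> is_prime (Ps i)) ->
  (forall i j, i \in s -> j \in s -> Ps i `<=` Ps j -> Ps i = Ps j) ->
  (forall i, i \in s -> ~ Q `<=` Ps i) ->
  exists2 b, Q b & forall i, i \in s -> ~ Ps i b.
Proof.
move=> hQ; elim: s => [|i s IH] hs eqs nQs.
  by exists 0; first exact: hQ.1.
have sub j : j \in s -> j \in i :: s by rewrite inE orbC => ->.
have [|||b Qb bP] := IH.
- by move=> j /sub; exact: hs.
- by move=> j k /sub js /sub; exact: eqs.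
- by move=> j /sub; exact: nQs.
have ii := mem_head i s; have [hi i1 iM] := hs _ ii.
have [ib|nib] := pselect (Ps i b); last first.
  by exists b => // j; rewrite inE => /predU1P[->|/bP].
(* A later prime inside [Ps i] would equal [Ps i] and so contain [b]. *)
have [|||a nia aP] := @avoid_meet T (Ps i) Ps s.
- exact: hs.
- by move=> j /sub/hs[].
- by move=> j js /(eqs _ _ (sub _ js) ii) e; apply: (bP j js); rewrite e.
have /existsNP[q /not_implyP[Qq niq]] := nQs i ii.
have niqa : ~ Ps i (q * a) by case/iM.
exists (b + q * a).
  by rewrite -[b]mul1r; apply: hQ.2 => //; exact: ideal_mulr.
move=> j; rewrite inE => /predU1P[->|js] bqa.
  by apply: niqa; rewrite -(addKr b (q * a)) addrC; exact: ideal_sub.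
have hj : is_ideal (Ps j) by case: (hs j (sub _ js)).
apply: (bP j js); rewrite -(addrK (q * a) b); apply: ideal_sub => //.
by apply: ideal_mull => //; exact: aP.
Qed.

End PrimeAvoidance.

(** * Zero divisors modulo an ideal *)

Section AssociatedPrimes.
Variables (A : comNzRingType) (I : set A).
Hypotheses (noethA : noetherian A) (idealI : is_ideal I).

Let colon c : set A := [set b | I (b * c)].

Let colon_ideal c : is_ideal (colon c).
Proof.
split; rewrite /colon /=; first by rewrite mul0r; exact: idealI.1.
by move=> a x y Ix Iy; rewrite mulrDl -mulrA; exact: idealI.2.
Qed.

(** The maximal annihilators of nonzero elements of A/I are the [colon c] for these [c]. *)
Let good c := ~ I c /\
  forall c', ~ I c' -> colon c `<=` colon c' -> colon c = colon c'.

(** If [x * y] kills [c] modulo [I] and [y] does not, then [colon c] lies in [colon (y * c)]. By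
    maximality the two agree, and [x] belongs to the second. *)
Let good_prime c : good c -> is_prime (colon c).
Proof.
move=> [nIc cmax]; split; rewrite /colon /=.
- exact: colon_ideal.
- by rewrite mul1r.
move=> x y Ixyc; have [|nIyc] := pselect (I (y * c)); first by right.
left; suff: colon c x by []; rewrite (cmax _ nIyc) /colon /= ?mulrA //.
by move=> b /= Ibc; rewrite mulrCA; exact: ideal_mull.
Qed.

Let good_above c0 : ~ I c0 -> exists2 c, good c & colon c0 `<=` colon c.
Proof.
move=> nI0; pose F := [set J | exists c,
  [/\ J = colon c, ~ I c & colon c0 `<=` colon c]].
have [||_ [c [-> nIc cP]] cmax] := @noetherian_maximal A F noethA.
- by exists (colon c0); exists c0; split.
- by move=> _ [c [-> _ _]]; exact: colon_ideal.
exists c => //; split=> // c' nIc' cc'; apply/esym/cmax => //.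
by exists c'; split=> //; exact: subset_trans cP cc'.
Qed.

(** Among the spans of finite lists of good elements take a maximal one; adjoining another good
    element cannot enlarge it. *)
Let good_span : exists s : seq A, (forall c, c \in s -> good c) /\
  forall c, good c -> lin_span idfun s c.
Proof.
pose F := [set J | exists s,
  J = lin_span idfun s /\ forall c, c \in s -> good c].
have [||_ [s [-> sP]] smax] := @noetherian_maximal A F noethA.
- by exists (lin_span idfun [::]), [::].
- by move=> _ [s [-> _]]; have := lin_span_submodule (idfun : A -> A) s.
exists s; split=> // c gc.
rewrite -(smax (lin_span idfun (c :: s))).
- by apply: mem_lin_span; exact: mem_head.
- by exists (c :: s); split=> // d; rewrite inE => /predU1P[->|/sP].
apply: lin_span_sub => [|x xs]; first exact: (lin_span_submodule idfun).
by apply: mem_lin_span; rewrite inE xs orbT.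
Qed.

(* The zero divisors on A/I form the union of the maximal annihilators (I : c);
   these are prime, and finitely many since the corresponding c generate a
   finitely generated ideal. *)
Lemma zero_divisors_annihilator (Q : set A) : is_ideal Q ->
  (forall b, Q b -> exists2 c, ~ I c & I (b * c)) ->
  exists2 c, ~ I c & forall b, Q b -> I (b * c).
Proof.
move=> hQ Qzd; apply: contrapT => nQ; have [s [sgood sP]] := good_span.
have [|||b Qb bP] := @prime_avoidance A A Q colon s hQ.
- by move=> c /sgood; exact: good_prime.
- by move=> c d /sgood[_ cmax] /sgood[nId _]; exact: cmax.
- by move=> c /sgood[nIc _] Qc; apply: nQ; exists c => // a /Qc.
have [c0 nI0 Ibc0] := Qzd b Qb; have [c gc c0c] := good_above nI0.
have [[d ds dc]|nd] := pselect (exists2 d, d \in s & colon d `<=` colon c).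
  have [_ /(_ c gc.1 dc) e] := sgood d ds.
  by apply: (bP d ds); rewrite e; exact: c0c.
(* In the remaining case some [a] outside [colon c] kills every element of [s] modulo [I], hence
   also [c], which lies in their span. *)
have [|||a nIac aP] := @avoid_meet A A (colon c) colon s.
- exact: good_prime.
- by move=> *; exact: colon_ideal.
- by move=> d ds dc; apply: nd; exists d.
apply: nIac; have : is_ideal [set x | I (a * x)].
  split=> [|u x y]; rewrite /= ?mulr0; first exact: idealI.1.
  by move=> Ix Iy; rewrite mulrDr mulrCA; exact: idealI.2.
move=> h; exact: (lin_span_sub (idealE h) aP (sP _ gc)).
Qed.

End AssociatedPrimes.

(** * Localizations of a domain, regular sequences and (S_2) *)

Section LocalizationTheory.
Variables (A : idomainType) (p : prime_idealr A).
Local Notation L := (localization p).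
Local Notation toL := (@toloc A p).

Lemma toloc_is_zmod_morphism : zmod_morphism toL.
Proof.
move=> a b; have -> : toL a - toL b = loc_add (toL a) (loc_opp (toL b)) by [].
rewrite !piE.
by apply: loc_pi_eq; rewrite /addl /embl /oppl /numer /denom /=; ring.
Qed.

Lemma toloc_is_monoid_morphism : monoid_morphism toL.
Proof.
split=> // a b; have -> : toL a * toL b = loc_mul (toL a) (toL b) by [].
rewrite !piE.
by apply: loc_pi_eq; rewrite /mull /embl /numer /denom /=; ring.
Qed.

HB.instance Definition _ :=
  GRing.isZmodMorphism.Build A L toL toloc_is_zmod_morphism.
HB.instance Definition _ :=
  GRing.isMonoidMorphism.Build A L toL toloc_is_monoid_morphism.

Lemma localizationP (x : L) :
  exists a s, s \notin p /\ x * toL s = toL a.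
Proof.
elim/quotW: x => x; exists (numer x), (denom x); split; first exact: denomP.
have -> : \pi_L x * toL (denom x) = loc_mul (\pi_L x) (toL (denom x)) by [].
rewrite !piE.
by apply: loc_pi_eq; rewrite /mull /embl /numer /denom /=; ring.
Qed.

Lemma toloc_unit s : s \notin p -> exists y : L, y * toL s = 1.
Proof.
move=> sp; exists (\pi_L (mkloc 1 sp)).
have -> : \pi_L (mkloc 1 sp) * toL s =
  loc_mul (\pi_L (mkloc 1 sp)) (toL s) by [].
have -> : (1 : L) = toL 1 by [].
rewrite !piE.
by apply: loc_pi_eq; rewrite /mull /embl /numer /denom /=; ring.
Qed.

Lemma toloc_inj : injective toL.
Proof.
move=> a b /eqP; rewrite !piE => /loc_equivP[u up].
rewrite /embl /numer /denom /= !mulr1; apply: mulfI.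
by apply: contraNneq up => ->; exact: idealr0.
Qed.

Lemma localization_cancel s (x y : L) : s \notin p ->
  x * toL s = y * toL s -> x = y.
Proof.
move=> /toloc_unit[z zs] /(congr1 (fun t => t * z)).
by rewrite -!mulrA ![toL s * z]mulrC zs !mulr1.
Qed.

Lemma localization_idomain (x y : L) : x * y = 0 -> x = 0 \/ y = 0.
Proof.
move=> xy0; have [a [s [sp xs]]] := localizationP x.
have [b [t [tp yt]]] := localizationP y.
have /eqP : a * b = 0.
  apply: toloc_inj; rewrite rmorphM /= -xs -yt rmorph0.
  by rewrite mulrACA xy0 mul0r.
rewrite mulf_eq0 => /orP[]/eqP e; [left|right].
  by apply: (localization_cancel sp); rewrite xs e rmorph0 mul0r.
by apply: (localization_cancel tp); rewrite yt e rmorph0 mul0r.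
Qed.

Lemma toloc_nonunit a : a \in p -> @nonunits L (toL a).
Proof.
move=> ap x; apply/eqP => ax1; have [b [s [sp xs]]] := localizationP x.
have e : s = a * b by apply: toloc_inj; rewrite rmorphM /= -xs mulrA ax1 mul1r.
by move: sp; rewrite e mulrC (idealMr).
Qed.

Lemma prime_nonunit (P : set L) : is_prime P -> P `<=` @nonunits L.
Proof.
move=> [hP P1 _] x Px y; apply/eqP => xy1; apply: P1; rewrite -xy1.
exact: ideal_mulr.
Qed.

Lemma toloc_prime_sub (P : set L) : is_prime P ->
  forall a, P (toL a) -> a \in p.
Proof.
move=> hP a /(prime_nonunit hP) nu; apply: contraT => /toloc_unit[y ya].
by have := nu y; rewrite mulrC ya eqxx.
Qed.

Lemma le_depth (s : seq L) : regular_sequence s ->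
  (forall x, x \in s -> @nonunits L x) -> (ext_nat (size s) <= depth L)%E.
Proof.
move=> rs nus; rewrite /depth.
(* The supremum over sequences is recast as one over a set of naturals. *)
rewrite (_ : [set ext_nat (size s) | s in _] = [set ext_nat n | n in
  [set n | exists s : seq L, [/\ regular_sequence s,
     forall x, x \in s -> @nonunits L x & size s = n]]]).
  by apply: ext_nat_le_supremum; exists s.
apply/seteqP; split=> [_ [t [rt nut] <-]|_ [_ [t [rt nut <-]] <-]].
  by exists (size t) => //; exists t.
by exists t.
Qed.

Lemma regular_nil : regular_sequence ([::] : seq L).
Proof.
by split=> // /(lin_span_nil (idfun : L -> L))/eqP; rewrite oner_eq0.
Qed.

Lemma lin_span1 (x y : L) : lin_span idfun [:: x] y <-> exists z, y = z * x.
Proof.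
split=> [/(lin_span_cons (idfun : L -> L))[z [u [+ ->]]]|[z ->]].
  move=> /(lin_span_nil (idfun : L -> L)) ->.
  by exists z; rewrite addr0.
apply/(lin_span_cons (idfun : L -> L)); exists z, 0.
by rewrite addr0; split=> //; apply/(lin_span_nil (idfun : L -> L)).
Qed.

Lemma regular1 (x : L) : x != 0 -> @nonunits L x -> regular_sequence [:: x].
Proof.
move=> x0 nux; split=> [[]//= _ y|/lin_span1[z e]].
  rewrite !(lin_span_nil (idfun : L -> L)) => /localization_idomain[] // /eqP.
  by rewrite (negPf x0).
by have := nux z; rewrite mulrC -e eqxx.
Qed.

Lemma regular2 (a b : A) : a != 0 -> a \in p -> b \in p ->
  (forall y : L, lin_span idfun [:: toL a] (toL b * y) ->
     lin_span idfun [:: toL a] y) ->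
  regular_sequence [:: toL a; toL b].
Proof.
move=> a0 ap bp reg; split=> [[|[|//]] //= _ y|].
rewrite !(lin_span_nil (idfun : L -> L)) => /localization_idomain[] // /eqP.
by rewrite -[0]/(toL 0) (inj_eq toloc_inj) (negPf a0).
move=> /(lin_span_cons (idfun : L -> L))[x [_ [/lin_span1[y ->]]]] /=.
have [c [s [sp xs]]] := localizationP x.
have [d [t [tp yt]]] := localizationP y.
(* Clearing denominators in [1 = x * toL a + y * toL b] would put [s * t] in [p]. *)
move=> /(congr1 (fun u => u * (toL s * toL t))); rewrite mul1r.
have -> : (x * toL a + y * toL b) * (toL s * toL t) =
  (x * toL s) * (toL t * toL a) + (y * toL t) * (toL s * toL b) by ring.
rewrite xs yt -!(rmorphM, rmorphD) => /toloc_inj e.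
have := prime_complM sp tp; rewrite e => /negP; apply.
by rewrite rpredD //= !idealMr.
Qed.

(** If no [b] works, every element of [p] is a zero divisor modulo the contraction of the ideal
    generated by [toL a]. Then a single [c] outside that contraction is multiplied into it by all of
    [p], and a common denominator brings this down to [A], where the hypothesis applies. *)
Lemma exists_regular2 a :
  noetherian A -> a != 0 -> a \in p ->
  (forall c, (forall q, q \in p -> exists d, q * c = a * d) ->
     exists d, c = a * d) ->
  exists b, b \in p /\ regular_sequence [:: toL a; toL b].
Proof.
move=> noethA a0 ap H; apply: contrapT => nreg.
(* The contraction to [A] of the ideal of [L] generated by [toL a]. *)
pose I : set A := [set c | exists s d, s \notin p /\ s * c = a * d].
have hI : is_ideal I.
  split; first by exists 1, 0; rewrite prime_compl1 !mulr0.
  move=> u x y [s [d [sp sx]]] [t [e [tp ty]]].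
  exists (s * t), (u * t * d + s * e); split; first exact: prime_complM.
  transitivity (u * t * (s * x) + s * (t * y)); first by ring.
  by rewrite sx ty; ring.
have [hp _ _] := prime_idealr_is_prime p.
have [|c nIc cP] :=
  @zero_divisors_annihilator A I noethA hI [set x | x \in p] hp.
  move=> b bp; apply: contrapT => nb; apply: nreg; exists b; split=> //.
  apply: regular2 => // y /lin_span1[z e]; apply: contrapT => ny; apply: nb.
  have [c [t [tp yt]]] := localizationP y.
  have [d [s [sp zs]]] := localizationP z.
  (* The numerator of [y] witnesses that [b] is a zero divisor modulo [I]. *)
  exists c.
    move=> [u [v [up uc]]]; apply: ny; apply/lin_span1.
    have [w wut] := toloc_unit (prime_complM up tp).
    exists (w * toL v); apply: (localization_cancel (prime_complM up tp)).
    have -> : w * toL v * toL a * toL (u * t) =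
      (w * toL (u * t)) * (toL a * toL v).
      by ring.
    rewrite wut mul1r -[in RHS]rmorphM -uc !rmorphM /= -yt; ring.
  exists s, (d * t); split=> //; apply: toloc_inj; rewrite !rmorphM /= -yt -zs.
  transitivity (toL b * y * (toL s * toL t)); first by ring.
  by rewrite e; ring.
(* The product of the denominators found for finitely many generators of [p] serves all of [p]. *)
have [s sp sP] : exists2 s, s \notin p &
    forall q, q \in p -> exists d, q * (s * c) = a * d.
  have [r defp] := noethA _ hp.
  have rp q : q \in r -> I (q * c).
    by move=> qr; apply: cP; rewrite defp; exact: mem_lin_span.
  have [s sp sr] : exists2 s, s \notin p &
      forall q, q \in r -> exists d, q * (s * c) = a * d.
    elim: (r) rp => [_|q r' IH h]; first by exists 1; rewrite // prime_compl1.
    have [|s sp sr] := IH; first by move=> x xr; apply: h; rewrite inE xr orbT.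
    have [t [d [tp td]]] := h _ (mem_head _ _).
    exists (s * t); first exact: prime_complM.
    move=> x; rewrite inE => /predU1P[->|/sr[e xe]].
      exists (s * d); transitivity (s * (t * (q * c))); first by ring.
      by rewrite td; ring.
    exists (t * e); transitivity (t * (x * (s * c))); first by ring.
    by rewrite xe; ring.
  exists s => // q qp; have : [set x | x \in p] q by [].
  rewrite defp; apply: (@lin_span_sub _ _ idfun
    [set q | exists d, q * (s * c) = a * d]) => //.
  split=> [|u x y [d xd] [e ye]] /=; first by exists 0; rewrite mul0r mulr0.
  exists (u * d + e).
  transitivity (u * (x * (s * c)) + y * (s * c)); first by ring.
  by rewrite xd ye; ring.
by have [d scd] := H _ sP; apply: nIc; exists s, d.
Qed.

End LocalizationTheory.

(* In terms of x = c / a in the fraction field, the hypothesis says that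
   Q x inside C forces x to be in C, for Q prime of height at least 2. *)
Lemma serre_S2_of (C : idomainType) : noetherian C ->
  (forall P Q : set C, is_prime P -> is_prime Q -> P `<` Q ->
     forall a c, P a -> a != 0 ->
     (forall q, Q q -> exists d, q * c = a * d) -> exists d, c = a * d) ->
  serre_S2 C.
Proof.
move=> noethC H; split=> // p; set L := localization p.
(* The regular sequence is empty for [n = 0]. For [n = 1] it is the numerator of an element of [c 1]
   outside [c 0], hence nonzero; for larger [n] this is extended by [exists_regular2]. *)
have chain_le n (c : 'I_n.+1 -> prime_idealr L) : prime_chain c ->
    (ext_nat (minn 2 n) <= depth L)%E.
  case: n c => [|n] c hc.
    have := le_depth (@regular_nil C p); rewrite minn0; apply => x.
    by rewrite in_nil.
  have h1 : (1 < n.+2)%N by [].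
  pose i1 : 'I_n.+2 := Ordinal h1; have e1 : i1 = 1%N :> nat by [].
  have [_ /existsNP[x /not_implyP[x1 /negP x0]]] := hc ord0 i1 isT.
  have hc1 := prime_idealr_is_prime (c i1).
  have [a [s [sp xs]]] := localizationP x.
  have a1 : toloc p a \in c i1 by rewrite -xs mulrC idealMr.
  have a0 : a != 0.
    apply: contraNneq x0 => a0.
    have -> : x = 0.
      by apply: (localization_cancel sp); rewrite xs a0 mul0r rmorph0.
    exact: idealr0.
  have ap : a \in p by exact: toloc_prime_sub hc1 _ a1.
  case: n c hc h1 i1 e1 x1 x0 hc1 a1 => [|n] c hc h1 i1 e1 x1 x0 hc1 a1.
    rewrite (_ : minn 2 1 = size [:: toloc p a]) //; apply: le_depth.
      apply: regular1; last exact: toloc_nonunit.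
      by rewrite -[0]/(toloc p 0) (inj_eq (@toloc_inj _ _)).
    by move=> y; rewrite inE => /eqP ->; exact: toloc_nonunit.
  have h2 : (2 < n.+3)%N by [].
  have h12 : (i1 < Ordinal h2)%N by rewrite e1.
  have [_ /existsNP[y /not_implyP[y2 /negP y1]]] := hc i1 (Ordinal h2) h12.
  have [b [t [tp yt]]] := localizationP y.
  have hc2 := prime_idealr_is_prime (c (Ordinal h2)).
  have bp : b \in p.
    by apply: (toloc_prime_sub hc2); rewrite /= -yt mulrC idealMr.
  have [|d [dp reg]] := @exists_regular2 C p a noethC a0 ap.
    (* The two primes are the contraction of [c 1] and [p] itself. The inclusion is strict: [b] is
       in [p], but [y = b / t] is not in [c 1]. *)
    have := H [set z | toloc p z \in c i1] [set z | z \in p].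
    move=> /(_ (@preimage_prime _ _ (@toloc C p) _ hc1)).
    move=> /(_ (prime_idealr_is_prime p)) Hp q; apply: Hp => //.
    split; first exact: toloc_prime_sub hc1.
    move=> /(_ b bp); rewrite /= -yt prime_idealrM (negPf y1) /= => t1.
    by move: tp; rewrite (toloc_prime_sub hc1 t1).
  rewrite (_ : minn 2 n.+2 = size [:: toloc p a; toloc p d]); last first.
    exact/minn_idPl.
  apply: le_depth => // z; rewrite !inE => /orP[]/eqP ->; exact: toloc_nonunit.
(* If the depth is below 2, then so is [minn 2 n], which therefore equals [n]; so the depth bounds
   every chain. *)
rewrite ge_min; have [//|dlt2] := leP (ext_nat 2) (depth L).
apply: supremum_ext_nat_le => n [c /chain_le cn].
have : (ext_nat (minn 2 n) < ext_nat 2)%E by exact: le_lt_trans cn dlt2.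
by move: cn; case: leqP => // ? _; rewrite ltxx.
Qed.

(** * Subrings of a field as integral domains *)

Section Subring.
Variables (K : fieldType) (S : set K).
Hypothesis hS : subring_closed (fun x : K => `[< S x >]).

(* The unused proof argument is what lets the closure instance be inferred. *)
Definition subring_pred of subring_closed (fun x : K => `[< S x >]) :
  {pred K} := fun x => `[< S x >].

HB.instance Definition _ :=
  GRing.isSubringClosed.Build K (subring_pred hS) hS.

Definition subring_of := {x : K | x \in subring_pred hS}.

HB.instance Definition _ := SubChoice.on subring_of.
HB.instance Definition _ := [SubChoice_isSubComNzRing of subring_of by <:].

Lemma subring_ofP (x : subring_of) : S (val x).
Proof. exact: asboolW (valP x). Qed.

Definition to_subring x (Sx : S x) : subring_of :=
  exist _ x (asboolT Sx).

(** An [idomainType] carries a unit predicate and an inverse. Both are taken classically inside the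
    subring, since the inverse in [K] may leave it. *)
Definition subring_unit : {pred subring_of} :=
  fun x => `[< exists y, y * x = 1 >].

Definition subring_inv (x : subring_of) : subring_of :=
  if pselect (exists y, y * x = 1) is left e then projT1 (cid e) else x.

Fact subring_mulVx : {in subring_unit, left_inverse 1 subring_inv *%R}.
Proof.
move=> x /asboolP xu; rewrite /subring_inv.
by case: pselect => // e; case: (cid e).
Qed.

Fact subring_unitPl (x y : subring_of) : y * x = 1 -> subring_unit x.
Proof. by move=> yx; apply/asboolP; exists y. Qed.

Fact subring_inv_out : {in [predC subring_unit], subring_inv =1 id}.
Proof.
move=> x /negP xu; rewrite /subring_inv.
by case: pselect => // e; case: xu; exact/asboolP.
Qed.

HB.instance Definition _ := GRing.ComNzRing_hasMulInverse.Build subring_of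
  subring_mulVx subring_unitPl subring_inv_out.

Fact subring_integral : GRing.integral_domain_axiom subring_of.
Proof.
move=> x y /(congr1 val)/eqP; rewrite rmorphM rmorph0 mulf_eq0.
by rewrite -!(rmorph0 (val : subring_of -> K)) !(inj_eq val_inj).
Qed.

HB.instance Definition _ :=
  GRing.ComUnitRing_isIntegral.Build subring_of subring_integral.

End Subring.

(** * Integrality and incomparability *)

Lemma integral_of_eigen (C : comNzRingType) (K : fieldType)
    (h : {rmorphism C -> K}) n (M : 'M[C]_n) (v : 'rV[K]_n) x :
  v != 0 -> v *m map_mx h M = x *: v -> integralOver h x.
Proof.
move=> v0 vM; exists (char_poly M); first exact: char_poly_monic.
by rewrite map_char_poly -eigenvalue_root_char; apply/eigenvalueP; exists v.
Qed.

(** The determinant trick: multiplication by [x] on finitely many generators of [P] is given by a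
    matrix over [C], and [x] is a root of its characteristic polynomial. *)
Lemma integral_of_stable_ideal (C : idomainType) (K : fieldType)
    (h : {rmorphism C -> K}) (P : set C) (a : C) x :
  noetherian C -> injective h -> is_ideal P -> P a -> a != 0 ->
  (forall z, P z -> exists2 w, P w & x * h z = h w) -> integralOver h x.
Proof.
move=> noethC h_inj hP Pa a0 Px; have [r defP] := noethC _ hP.
have Pr (i : 'I_(size r)) : P r`_i.
  by rewrite defP; apply: mem_lin_span; exact: mem_nth.
have Mex (i : 'I_(size r)) : exists c : 'I_(size r) -> C,
    x * h r`_i = h (\sum_(j < size r) c j * r`_j).
  by have [w + ->] := Px _ (Pr i); rewrite {1}defP => -[c ->]; exists c.
have [m mP] := choice Mex.
(* Eigenvectors are rows here, so column [j] holds the coordinates of [x * h r_j]. *)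
pose M := \matrix_(i < size r, j < size r) m j i.
apply: (@integral_of_eigen C K h _ M (\row_i h r`_i)); last first.
  apply/rowP => j; rewrite !mxE mP rmorph_sum; apply: eq_bigr => i _.
  by rewrite !mxE rmorphM mulrC.
(* Were all generators zero, their combination [a] would vanish too. *)
apply: contraNneq a0 => r0; apply/eqP; apply: h_inj; rewrite rmorph0.
have : P a by []; rewrite {1}defP => -[c ->].
rewrite rmorph_sum big1 // => i _.
have := congr1 (fun u : 'rV[K]_(size r) => u 0 i) r0; rewrite !mxE => ri0.
by rewrite /= rmorphM ri0 mulr0.
Qed.

(** Transitivity: [x] is a root of a monic polynomial whose coefficients are integral over [B]. *)
Lemma integral_through (B C : comNzRingType) (K : fieldType)
    (g : {rmorphism B -> C}) (h : {rmorphism C -> K}) x :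
  (forall c, integralOver (h \o g) (h c)) -> integralOver h x ->
  integralOver (h \o g) x.
Proof.
move=> intC [q qmon qx]; apply: (integral_root_monic (p := map_poly h q)).
- exact: monic_map.
- exact: qx.
- by apply/integral_poly => i; rewrite coef_map; exact: intC.
Qed.

Lemma integral_reflect (B C : comNzRingType) (K : fieldType)
    (g : {rmorphism B -> C}) (h : {rmorphism C -> K}) c : injective h ->
  integralOver (h \o g) (h c) -> integralOver g c.
Proof.
move=> h_inj [q qmon]; rewrite map_poly_comp /root horner_map -(rmorph0 h).
by rewrite (inj_eq h_inj) => qc; exists q.
Qed.

(** For [y] in [Q], take a monic polynomial over [B] with value at [y] in [P]. Its constant term
    lies in [Q], hence in [P], so [y] times the value of the monic quotient lies in [P]. Either [y]
    is in [P] or the degree drops; it cannot reach 0, as 1 is not in [P]. *)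
Lemma incomparability (B C : comNzRingType) (g : {rmorphism B -> C})
    (P Q : set C) : is_prime P -> is_ideal Q -> P `<=` Q ->
  (forall y, Q y -> integralOver g y) -> (forall b, Q (g b) -> P (g b)) ->
  Q `<=` P.
Proof.
move=> [hP P1 PM] hQ PQ intQ QP y Qy; have [f fmon /rootP fy] := intQ y Qy.
have : P (map_poly g f).[y] by rewrite fy; exact: hP.1.
elim/poly_ind: f fmon {fy} => [|f c IH].
  by rewrite monicE lead_coef0 eq_sym oner_eq0.
rewrite rmorphD rmorphM /= map_polyX map_polyC hornerMXaddC /=.
have [->|f0] := eqVneq f 0.
  rewrite mul0r add0r monicE lead_coefC => /eqP ->.
  by rewrite rmorph0 horner0 mul0r add0r rmorph1 => /P1.
rewrite monicE lead_coefDl; last first.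
  rewrite size_mulX // size_polyC ltnS (leq_trans (leq_b1 _)) //.
  by rewrite size_poly_gt0.
rewrite lead_coefMX => fmon Pf.
have Pc : P (g c).
  apply: QP; rewrite -(addKr ((map_poly g f).[y] * y) (g c)) addrC.
  by apply: ideal_sub => //; [exact: PQ | exact: ideal_mull].
have /PM[|//] : P ((map_poly g f).[y] * y).
  by rewrite -(addrK (g c) (_ * y)); exact: ideal_sub.
exact: IH.
Qed.

(** Otherwise 0, [P], [p] would be a strict chain of length 2 ending at [p]. *)
Lemma height1_minimal (B : idomainType) (p : prime_idealr B) (P : set B) b :
  height p = ext_nat 1 -> is_prime P -> P b -> b != 0 ->
  (forall x, P x -> x \in p) -> forall x, x \in p -> P x.
Proof.
move=> htp hP Pb b0 Pp; apply: contrapT => npP.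
have h0 := zero_prime B.
pose c (i : 'I_3) : prime_idealr B :=
  if i == 0%N :> nat then prime_of h0
  else if i == 1%N :> nat then prime_of hP else p.
have : (ext_nat 2 <= ext_nat 1)%E.
  rewrite -htp; apply: ext_nat_le_supremum; exists c; split=> //.
  have s01 : {subset prime_of h0 <= prime_of hP}.
    by have [[P0 _] _ _] := hP; move=> x /mem_prime_of ->; apply/mem_prime_of.
  have n01 : ~ {subset prime_of hP <= prime_of h0}.
    by move=> /(_ b); rewrite !mem_prime_of => /(_ Pb); exact/eqP.
  have s12 : {subset prime_of hP <= p} by move=> x /mem_prime_of/Pp.
  have n12 : ~ {subset p <= prime_of hP}.
    by move=> s; apply: npP => x /s/mem_prime_of.
  case=> [[|[|[|//]]]] ? [[|[|[|//]]]] ? //= _; rewrite /c /=; split=> //.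
    by move=> x /s01/s12.
  by move=> s; apply: n12 => x /s; exact: s01.
by rewrite lee_fin.
Qed.

(** * The hull and its properties *)

Section S2Hull.
Variable B : idomainType.
Hypotheses (noethB : noetherian B) (normB : finite_normalization B).
Local Notation K := {fraction B}.
Local Notation iota := (@tofrac B : B -> K).

Definition S2_hull : set K := [set x | integral_closure B x /\
  forall p : prime_idealr B, height p = ext_nat 1 ->
    exists b t, t \notin p /\ x * iota t = iota b].

Fact S2_hull_subring : subring_closed (fun x : K => `[< S2_hull x >]).
Proof.
split=> [|x y /asboolP[ix hx] /asboolP[iy hy]|
  x y /asboolP[ix hx] /asboolP[iy hy]]; apply/asboolP; split.
- exact: integral1.
- by move=> p _; exists 1, 1; rewrite prime_compl1 mul1r.
- exact: integral_sub.
- move=> p hp; have [b [t [tp xt]]] := hx p hp; have [c [u [up yu]]] := hy p hp.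
  exists (b * u - c * t), (t * u); split; first exact: prime_complM.
  by rewrite rmorphB !rmorphM /= -xt -yu; ring.
- exact: integral_mul.
- move=> p hp; have [b [t [tp xt]]] := hx p hp; have [c [u [up yu]]] := hy p hp.
  exists (b * c), (t * u); split; first exact: prime_complM.
  by rewrite !rmorphM /= -xt -yu; ring.
Qed.

Local Notation C := (subring_of S2_hull_subring).
Local Notation h := (val : C -> K).

Fact tofrac_S2_hull b : S2_hull (iota b).
Proof.
split; first exact: integral_id.
by move=> p _; exists b, 1; rewrite prime_compl1 rmorph1 mulr1.
Qed.

Definition S2_hull_incl (b : B) : C :=
  to_subring S2_hull_subring (tofrac_S2_hull b).
Local Notation g := S2_hull_incl.

Fact S2_hull_incl_zmod : zmod_morphism g.
Proof. by move=> x y; apply: val_inj; rewrite rmorphB /= rmorphB. Qed.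

Fact S2_hull_incl_monoid : monoid_morphism g.
Proof.
split=> [|x y]; apply: val_inj; first by rewrite rmorph1 /= rmorph1.
by rewrite rmorphM /= rmorphM.
Qed.

HB.instance Definition _ := GRing.isZmodMorphism.Build B C g S2_hull_incl_zmod.
HB.instance Definition _ :=
  GRing.isMonoidMorphism.Build B C g S2_hull_incl_monoid.

Lemma S2_hull_incl_inj : injective g.
Proof. by move=> x y /(congr1 h)/eqP; rewrite /= tofrac_eq => /eqP. Qed.

Lemma S2_hull_finite : finite_map g.
Proof.
have [s defB'] := normB.
have [|x [ix _]|t deft] := @submodule_fg _ _ iota noethB s S2_hull.
- have [S1 SB SM] := S2_hull_subring; split.
    by rewrite -(rmorph0 iota); exact: tofrac_S2_hull.
  (* Subring closure speaks of differences, so the sum is written as [a x - (0 - y)]. *)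
  move=> a x y Sx Sy; apply/asboolP; rewrite -[y]opprK -[- y]sub0r.
  apply: (SB); first by apply: SM; apply/asboolP => //; exact: tofrac_S2_hull.
  apply: SB; apply/asboolP => //.
  by rewrite -(rmorph0 iota); exact: tofrac_S2_hull.
- by rewrite -defB'.
(* The generators found in [K] lie in the hull; they are lifted to [C], and the spanning relations
   follow by injectivity of [val]. *)
have [r defr] : exists r : seq C, map h r = t.
  have : forall x, x \in t -> S2_hull x.
    by move=> x; rewrite deft; exact: mem_lin_span.
  elim: (t) => [|x u IH] xS; first by exists [::].
  have [|r <-] := IH; first by move=> y yu; apply: xS; rewrite inE yu orbT.
  by exists (to_subring S2_hull_subring (xS x (mem_head _ _)) :: r).
exists r; apply/seteqP; split=> // c _.
have : lin_span iota (map h r) (h c) by rewrite defr -deft; exact: subring_ofP.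
elim: r {defr} c => [|x r IH] c.
  move/lin_span_nil => c0; apply/lin_span_nil; apply: val_inj.
  by rewrite c0 rmorph0.
case/lin_span_cons => a [y [ry e]]; apply/lin_span_cons.
exists a, (c - g a * x); split; last by rewrite addrC subrK.
by apply: IH; rewrite rmorphB rmorphM /= e [_ + y]addrC addrK.
Qed.

Lemma S2_hull_height1 (p : prime_idealr B) : height p = ext_nat 1 ->
  loc_base g p = loc_ext g p.
Proof.
move=> htp; apply/seteqP; split=> [_ [b [s [sp ->]]]|_ [c [s [sp ->]]]].
  by exists (g b), s.
have [_ /(_ p htp)[b [t [tp e]]]] := subring_ofP c.
(* Hence [c / s] equals [b / (s * t)] in the fraction field of [C]. *)
have {}e : c * g t = g b by apply: val_inj; rewrite rmorphM.
have gt0 : tofrac (g t) != 0.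
  rewrite tofrac_eq0 -(rmorph0 g) (inj_eq S2_hull_incl_inj).
  by apply: contraNneq tp => ->; exact: idealr0.
exists b, (s * t); split; first exact: prime_complM.
by rewrite -e !rmorphM /= -mulf_div divff // mulr1.
Qed.

Lemma S2_hull_S2 : serre_S2 C.
Proof.
have noethC : noetherian C by exact: finite_noetherian noethB S2_hull_finite.
have intC c : integralOver g c.
  apply: (@integral_reflect _ _ _ g h); first exact: val_inj.
  by case: (subring_ofP c).
apply: serre_S2_of => // P Q hP hQ [PQ nQP] a c Pa a0 Qc.
have [idP P1 PM] := hP; have [idQ _ _] := hQ.
have ha0 : h a != 0 by rewrite -(rmorph0 h) (inj_eq val_inj).
pose x := h c / h a.
have xa d q : q * c = a * d -> x * h q = h d.
  move=> /(congr1 h); rewrite !rmorphM => e; apply: (mulIf ha0).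
  by rewrite /x mulrAC divfK // mulrC e mulrC.
suff Sx : S2_hull x.
  exists (to_subring S2_hull_subring Sx); apply: val_inj.
  by rewrite rmorphM /= /x mulrC divfK.
have intx : integralOver h x.
  apply: (@integral_of_stable_ideal C K h P a x noethC) => //.
    exact: val_inj.
  have /existsNP[q /not_implyP[Qq nPq]] := nQP.
  have [e qe] := Qc q Qq.
  move=> z Pz; have [d zd] := Qc z (PQ z Pz); exists d; last exact: xa.
  (* Here [d = x z] and [e = x q], so [q * d = z * e] lies in [P] while [q] does not. *)
  have /PM[] // : P (q * d).
  suff -> : q * d = z * e by exact: ideal_mulr.
  apply: (mulfI a0).
  transitivity (q * (a * d)); first by ring.
  rewrite -zd; transitivity (z * (q * c)); first by ring.
  by rewrite qe; ring.
split.
  apply: (@integral_through B C K g h) => // d.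
  by case: (subring_ofP d).
move=> p htp; apply: contrapT => nx.
have Qp b : Q (g b) -> b \in p.
  move=> Qb; apply: contraT => bp; case: nx.
  have [d /xa e] := Qc _ Qb.
  have [_ /(_ p htp)[b' [t [tp et]]]] := subring_ofP d.
  (* With [b] outside [p] and [x b = b' / t], the fraction [b' / (b * t)] would put [x] in B_p. *)
  exists b', (b * t); split; first exact: prime_complM.
  by rewrite rmorphM /= mulrA e.
(* Otherwise [P] and 0 would both contract to 0, and incomparability would force [P] to be 0,
   although it contains [a]. *)
have [b Pb b0] : exists2 b, P (g b) & b != 0.
  apply: contrapT => nb.
  have : P `<=` [set 0]; last by move=> /(_ a Pa)/eqP; rewrite (negPf a0).
  apply: (@incomparability B C g) => //.
  - exact: zero_prime.
  - by move=> _ ->; exact: idP.1.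
  - move=> b Pb /=; have [->|b0] := eqVneq b 0; first exact: rmorph0.
    by case: nb; exists b.
(* The contraction of [P] is nonzero and inside [p], hence all of [p] by height 1; that of [Q] is
   inside [p] as well. *)
apply: nQP; apply: (@incomparability B C g) => // b' /Qp b'p.
apply: (height1_minimal htp (@preimage_prime _ _ g _ hP) Pb b0) => //.
by move=> z Pz; apply: Qp; exact: PQ.
Qed.

End S2Hull.

Lemma finite_S2_ification (B : idomainType) :
  noetherian B -> finite_normalization B -> has_finite_S2_ification B.
Proof.
move=> noethB normB.
exists (subring_of (@S2_hull_subring B)), (@S2_hull_incl B).
split; [exact: S2_hull_incl_inj | exact: S2_hull_finite | exact: S2_hull_S2 |].
exact: S2_hull_height1.
Qed.

Theorem corollary1p4 :
  (forall R : comPzRingType, nagata R -> semi_nagata R) /\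
  (forall R : idomainType, nagata R -> has_finite_S2_ification R).
Proof.
have semi (R : comPzRingType) : nagata R -> semi_nagata R.
  move=> [noethR normR]; split=> // B f finf.
  apply: finite_S2_ification; first exact: finite_noetherian finf.
  exact: normR finf.
(* A domain is a finite algebra over itself, generated by 1. *)
split=> // R /semi[_ /(_ R idfun)]; apply.
exists [:: 1]; apply/seteqP; split=> // x _; apply/lin_span_cons.
by exists x, 0; rewrite mulr1 addr0; split=> //; apply/lin_span_nil.
Qed.
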